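(* Let $v\mapsto H_v$ be a $3$-acyclic region representation of a (possibly infinite) graph $G$ over a graph $H$, and let $r>3$ be an integer. Then $G$ is $r$-locally chordal if and only if $v\mapsto H_v$ is $r$-acyclic.
   Context: All graphs are simple and possibly infinite. A region of $H$ is a nonempty connected subgraph. A region representation of $G$ over a graph $H$ is a map $v\mapsto H_v$ assigning to each vertex of $G$ a region of $H$ such that, for distinct $u,v$, $uv\in E(G)$ iff $H_u\cap H_v\neq\emptyset$. For an integer $k$, it is $k$-acyclic if for every $X\subseteq V(G)$ with $|X|\le k$ the union $\bigcup_{x\in X}H_x$ is acyclic. The ball $B_{r/2}(v)$ is the subgraph of $G$ whose vertices are those at distance at most $r/2$ from $v$ and whose edges are the edges of $G$ for which the sum of the distances of the endpoints to $v$ is strictly less than $r$. A graph is chordal if each of its cycles of length at least $4$ has a chord; $G$ is $r$-locally chordal if every ball $B_{r/2}(v)$, $v\in V(G)$, is chordal. *)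

(* Defs.v *)
From mathcomp Require Import all_boot.
From mathcomp Require Import boolp classical_sets functions cardinality.
Set Implicit Arguments.
Unset Strict Implicit.
Unset Printing Implicit Defensive.

Local Open Scope classical_set_scope.

(* Simple graphs whose vertices are drawn from an ambient type T; keeping the
   vertex set inside T lets subgraphs, unions and balls be graphs over the same
   type. *)
Record graph (T : Type) := Graph {
  vert : set T;
  edge : T -> T -> Prop;
  edge_sym : forall x y, edge x y -> edge y x;
  edge_irrefl : forall x, ~ edge x x;
  edge_vert : forall x y, edge x y -> vert x }.

Definition subgraph T (A B : graph T) : Prop :=
  vert A `<=` vert B /\ forall x y, edge A x y -> edge B x y.

Inductive walk T (G : graph T) : nat -> T -> T -> Prop :=
| walk0 u : vert G u -> walk G 0 u u
| walkS n u v w : walk G n u v -> edge G v w -> walk G n.+1 u w.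

Definition connected T (G : graph T) : Prop :=
  forall u v, vert G u -> vert G v -> exists n, walk G n u v.

(* A relation, since vertices in different components have no finite
   distance. *)
Definition is_dist T (G : graph T) (u v : T) (d : nat) : Prop :=
  walk G d u v /\ forall n, walk G n u v -> d <= n.

(* c is the cyclic sequence of the n vertices of a cycle; [ordS] is the
   successor modulo n. *)
Definition is_cycle T (G : graph T) (n : nat) (c : 'I_n -> T) : Prop :=
  [/\ 3 <= n, injective c & forall i, edge G (c i) (c (ordS i))].

Definition acyclic T (G : graph T) : Prop :=
  forall n (c : 'I_n -> T), ~ is_cycle G c.

Definition has_chord T (G : graph T) (n : nat) (c : 'I_n -> T) : Prop :=
  exists i j, [/\ i != j, j != ordS i, i != ordS j & edge G (c i) (c j)].

Definition chordal T (G : graph T) : Prop :=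
  forall n (c : 'I_n -> T), 4 <= n -> is_cycle G c -> has_chord G c.

Section HalfBall.
Context {T : Type} (G : graph T) (r : nat) (v : T).

Definition half_ball_vert : set T :=
  [set x | exists2 d, is_dist G v x d & d.*2 <= r].

Definition half_ball_edge (x y : T) : Prop :=
  edge G x y /\ exists d e, [/\ is_dist G v x d, is_dist G v y e & d + e < r].

Lemma half_ball_edge_sym x y : half_ball_edge x y -> half_ball_edge y x.
Proof.
move=> [xy [d [e [dx ey lt_r]]]]; split; first exact: edge_sym.
by exists e, d; split=> //; rewrite addnC.
Qed.

Lemma half_ball_edge_irrefl x : ~ half_ball_edge x x.
Proof. by move=> [xx _]; exact: edge_irrefl xx. Qed.

Lemma half_ball_edge_vert x y : half_ball_edge x y -> half_ball_vert x.
Proof.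
move=> [xy [d [e [dx [wy _] lt_r]]]]; exists d => //.
have le_de : d <= e.+1 by apply: dx.2; apply: walkS wy (edge_sym xy).
rewrite -addnn; apply: leq_trans lt_r.
by rewrite -addnS leq_add2l.
Qed.

(* The ball of radius r/2 around v; halves are cleared, so that distance at
   most r/2 reads d.*2 <= r. *)
Definition half_ball : graph T :=
  Graph half_ball_edge_sym half_ball_edge_irrefl half_ball_edge_vert.

End HalfBall.

Definition locally_chordal T (r : nat) (G : graph T) : Prop :=
  forall v, vert G v -> chordal (half_ball G r v).

Section Union.
Context {V W : Type} (R : V -> graph W) (X : set V).

Definition union_edge (a b : W) : Prop := exists2 x, X x & edge (R x) a b.

Lemma union_edge_sym a b : union_edge a b -> union_edge b a.
Proof. by move=> [x Xx ab]; exists x => //; apply: edge_sym. Qed.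

Lemma union_edge_irrefl a : ~ union_edge a a.
Proof. by move=> [x _ aa]; exact: edge_irrefl aa. Qed.

Lemma union_edge_vert a b :
  union_edge a b -> (\bigcup_(x in X) vert (R x)) a.
Proof. by move=> [x Xx ab]; exists x => //; apply: edge_vert ab. Qed.

Definition graph_union : graph W :=
  Graph union_edge_sym union_edge_irrefl union_edge_vert.

End Union.

Definition region W (H A : graph W) : Prop :=
  [/\ subgraph A H, vert A !=set0 & connected A].

(* Only the values of R at vertices of G matter. *)
Definition region_representation V W (G : graph V) (H : graph W)
    (R : V -> graph W) : Prop :=
  (forall v, vert G v -> region H (R v)) /\
  (forall u v, vert G u -> vert G v -> u <> v ->
     (edge G u v <-> vert (R u) `&` vert (R v) !=set0)).

Definition k_acyclic V W (G : graph V) (R : V -> graph W) (k : nat) : Prop :=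
  forall X : set V, X `<=` vert G -> (X #<= `I_k)%card ->
    acyclic (graph_union R X).

(* Main.v *)
Require Import Defs.
From mathcomp Require Import all_boot.
From mathcomp Require Import boolp classical_sets functions cardinality.
From mathcomp Require Import zify.
(** Write U_Y for the union of the regions of the vertices in Y, and N(x) for
    the neighbours of x in G. Everything rests on one local criterion: for a
    vertex x outside Y,

    - if U_Y is acyclic and G[N(x) & Y] is connected, then U_(Y + x) is acyclic
      ([acyclic_union_add]);
    - if U_(Y + x) is acyclic and G[Y] is connected, then G[N(x) & Y] is
      connected ([nbrs_connected_of_acyclic]).

    Both come from two facts about forests. Connected subgraphs of a forest
    meet in a connected graph ([meet_connected]), and two forests meeting in a
    connected graph have an acyclic union ([acyclic_glue]). 3-acyclicity lets
    the connectedness of the meet of R_x and U_Y be read off G[N(x) & Y]: if y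
    and z are adjacent neighbours of x, then the part of R_x inside the union
    of R_y and R_z is connected.

    Locally chordal implies r-acyclic. The regions traversed by a cycle in U_X
    form a walk in G, so it suffices to add the vertices of a walk one by one.
    If G[N(x) & Y] is disconnected although G[Y] is connected, a shortest path
    in G[Y] between two of its components with no neighbour of x inside closes
    up through x to an induced cycle. It has at least 4 and at most |X| <= r
    vertices, so it lies in the ball around x and contradicts chordality
    ([nbrs_connected_of_locally_chordal], [short_cycle_chord]).

    r-acyclic implies locally chordal. Layer the vertices by their distance to
    a centre v. The second half of the criterion, applied to two geodesics
    towards v, shows that two neighbours one level below a vertex of level at
    most r/2 are adjacent ([lower_nbrs_adjacent]), and that adjacent vertices
    of a common level below r/2 have a common neighbour one level below
    ([common_lower_nbr]). Hence, if 2d < r, the first half allows adding whole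
    layers vertex by vertex, so the union of all regions up to level d is
    acyclic, no matter how many there are ([acyclic_union_layers]). A cycle of
    length at least 4 in the ball that reaches level exactly r/2 has a chord by
    the adjacency of lower neighbours; any other one lies in the acyclic part,
    where the second half of the criterion gives the chord. *)

Set Implicit Arguments.
Unset Strict Implicit.
Unset Printing Implicit Defensive.

Local Open Scope classical_set_scope.

(** * Walks, geodesics and cycles *)

Section Walks.
Context {T : Type}.
Implicit Types (G A B : graph T) (u v w : T).

Definition linked G u v := exists n, walk G n u v.

Lemma edge_vertr G u v : edge G u v -> vert G v.
Proof. by move=> uv; apply: edge_vert (edge_sym uv). Qed.

Lemma walk_vertl G n u v : walk G n u v -> vert G u.
Proof. by elim. Qed.

Lemma walk_vertr G n u v : walk G n u v -> vert G v.
Proof. by case=> // {}n {}u w {}v _ wv; apply: edge_vertr wv. Qed.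

Lemma walk_edge G u v : edge G u v -> walk G 1 u v.
Proof. by move=> uv; apply: walkS (uv); apply: walk0; apply: edge_vert uv. Qed.

Lemma walk_trans G m n u v w : walk G m u v -> walk G n v w -> walk G (m + n) u w.
Proof.
move=> uv vw; elim: vw uv => [x _|{}n x y z _ IH yz] uv; first by rewrite addn0.
by rewrite addnS; apply: walkS yz; apply: IH.
Qed.

Lemma walk_sym G n u v : walk G n u v -> walk G n v u.
Proof.
elim=> [x Gx|{}n x y z _ IH yz]; first exact: walk0.
by rewrite -add1n; apply: walk_trans IH; apply: walk_edge; apply: edge_sym.
Qed.

Lemma walk_sub A B n u v : subgraph A B -> walk A n u v -> walk B n u v.
Proof.
move=> [sV sE]; elim=> [x /sV|{}n x y z _ IH /sE]; first exact: walk0.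
exact: walkS.
Qed.

Lemma linked_refl G u : vert G u -> linked G u u.
Proof. by exists 0; apply: walk0. Qed.

Lemma linked_edge G u v : edge G u v -> linked G u v.
Proof. by exists 1; apply: walk_edge. Qed.

Lemma linked_sym G u v : linked G u v -> linked G v u.
Proof. by move=> [n /walk_sym]; exists n. Qed.

Lemma linked_trans G v u w : linked G u v -> linked G v w -> linked G u w.
Proof. by move=> [m uv] [n vw]; exists (m + n); apply: walk_trans uv vw. Qed.

Lemma linked_sub A B u v : subgraph A B -> linked A u v -> linked B u v.
Proof. by move=> sAB [n /(walk_sub sAB)]; exists n. Qed.

Lemma linked_dist G u v : linked G u v -> exists d, is_dist G u v d.
Proof.
move=> [n uv]; have ex : exists n, `[< walk G n u v >] by exists n; apply/asboolP.
case: (ex_minnP ex) => d /asboolP duv dmin; exists d; split=> // k kuv.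
by apply: dmin; apply/asboolP.
Qed.

Lemma dist_le G u v n : walk G n u v -> exists2 d, is_dist G u v d & d <= n.
Proof.
move=> uv; have [|d [duv dmin]] := @linked_dist G u v; first by exists n.
by exists d; last exact: dmin.
Qed.

Lemma connected_nbr G u v :
  connected G -> vert G u -> vert G v -> u <> v -> exists w, edge G u w.
Proof.
move=> cG Gu Gv uv; have [n vu] := cG v u Gv Gu.
by case: vu uv => [//|{}n a w b _ wb _]; exists w; apply: edge_sym.
Qed.

Lemma path_walk G (p : nat -> T) i j : i <= j -> vert G (p i) ->
  (forall k, i <= k < j -> edge G (p k) (p k.+1)) -> walk G (j - i) (p i) (p j).
Proof.
elim: j => [|j IH]; first by rewrite leqn0 => /eqP-> ? _; apply: walk0.
rewrite leq_eqVlt => /predU1P[<- Gi _|lt_ij Gi ep].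
  by rewrite subnn; apply: walk0.
rewrite subSn //; apply: walkS (ep j _); last by lia.
by apply: IH => // k k_ij; apply: ep; lia.
Qed.

Lemma walk_path G n u v : walk G n u v ->
  exists p : nat -> T, [/\ p 0 = u, p n = v &
    forall i, i < n -> edge G (p i) (p i.+1)].
Proof.
elim=> [x Gx|{}n x y z _ [p [p0 pn ep]] yz]; first by exists (fun=> x).
exists (fun i => if i <= n then p i else z); split=> [//||i].
  by rewrite ltnn.
rewrite ltnS => le_in; rewrite le_in; case: ltnP => [lt_in|le_ni]; first exact: ep.
have -> : i = n by apply/eqP; rewrite eqn_leq le_in.
by rewrite pn.
Qed.

(** A shortest path is induced: a repeated vertex or an edge between two
    vertices at positions i and j > i + 1 would give a shorter walk. *)
Lemma geodesic G n u v : is_dist G u v n ->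
  exists p : nat -> T, [/\ p 0 = u, p n = v,
    forall i, i < n -> edge G (p i) (p i.+1),
    forall i j, i <= n -> j <= n -> p i = p j -> i = j &
    forall i j, i < j -> j <= n -> edge G (p i) (p j) -> j = i.+1].
Proof.
move=> [uv min]; have [p [p0 pn ep]] := walk_path uv; exists p.
have Gp i : i <= n -> vert G (p i).
  rewrite leq_eqVlt => /predU1P[->|lt_in].
    by rewrite pn; apply: walk_vertr uv.
  exact: edge_vert (ep i lt_in).
have seg i j : i <= j -> j <= n -> walk G (j - i) (p i) (p j).
  by move=> ij jn; apply: path_walk => // [|k k_ij]; [apply: Gp|apply: ep]; lia.
have short i j k : i <= n -> j <= n -> walk G k (p i) (p j) -> j <= i + k.
  move=> le_in le_jn ij.
  have := min (i + k + (n - j)); rewrite -p0 -pn.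
  have /walk_trans/(_ ij)/walk_trans/(_ (seg j n le_jn (leqnn n))) :=
    seg 0 i (leq0n i) le_in.
  by rewrite subn0 => w /(_ w); lia.
have inj i j : i <= n -> j <= n -> p i = p j -> j <= i.
  move=> le_in le_jn pij; rewrite -[i]addn0; apply: short => //.
  by rewrite pij; apply: walk0; apply: Gp.
split=> // [i j le_in le_jn pij|i j lt_ij le_jn eij].
  by apply/eqP; rewrite eqn_leq; apply/andP; split; apply: inj.
have := short i j 1 _ le_jn (walk_edge eij); lia.
Qed.

Lemma closed_path_cycle G n (p : nat -> T) : 3 <= n -> p n = p 0 ->
  (forall i, i < n -> edge G (p i) (p i.+1)) ->
  (forall i j, i < n -> j < n -> p i = p j -> i = j) ->
  is_cycle G (fun i : 'I_n => p i).
Proof.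
move=> n3 pn ep injp; split=> // [i j /injp ij|i].
  by apply/val_inj/ij.
rewrite /=; have := ltn_ord i; rewrite leq_eqVlt => /predU1P[iE|lt_in].
  by rewrite iE modnn -pn -{2}iE; apply: ep.
by rewrite modn_small //; apply: ep.
Qed.

Lemma cycle_sub A B n (c : 'I_n -> T) :
  (forall x y, edge A x y -> edge B x y) -> is_cycle A c -> is_cycle B c.
Proof. by move=> sE [n3 injc ec]; split=> // i; apply: sE. Qed.

Lemma acyclic_sub A B :
  (forall x y, edge A x y -> edge B x y) -> acyclic B -> acyclic A.
Proof. by move=> sE aB n c /(cycle_sub sE) /aB. Qed.

Lemma ordS_cases n (i : 'I_n) :
  (i.+1 = n /\ ordS i = 0 :> nat) \/ (i.+1 < n /\ ordS i = i.+1 :> nat).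
Proof.
have := ltn_ord i; rewrite leq_eqVlt /= => /predU1P[->|lt_i].
  by rewrite modnn; left.
by rewrite modn_small //; right.
Qed.

Lemma chord_skipping_one G n (c : 'I_n -> T) j : 4 <= n ->
  edge G (c j) (c (ordS (ordS j))) -> has_chord G c.
Proof.
move=> n4 ej; exists j, (ordS (ordS j)); split=> //;
  apply/eqP => /(congr1 (@nat_of_ord n)); move: (ordS_cases j);
  case: (ordS_cases (ordS j)) (ordS_cases (ordS (ordS j))) =>
    [[? ?]|[? ?]] [[? ?]|[? ?]]; lia.
Qed.

End Walks.

(** * Forests: edge cuts, meets and gluing *)

Section Cuts.
Context {T : Type}.
Implicit Types (G A B C : graph T) (u v : T) (S : set T).

(** S witnesses that uv is a bridge. Cuts are easier to restrict and to glue
    than cycles, so acyclicity is used through them. *)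
Definition cuts G u v S := [/\ S u, ~ S v &
  forall x y, edge G x y -> S x -> ~ S y -> x = u /\ y = v].

Section DelEdge.
Variables (G : graph T) (u v : T).

Definition del_edge_edge x y :=
  [/\ edge G x y, ~ (x = u /\ y = v) & ~ (x = v /\ y = u)].

Lemma del_edge_sym x y : del_edge_edge x y -> del_edge_edge y x.
Proof. by move=> [xy nuv nvu]; split; [apply: edge_sym|tauto|tauto]. Qed.

Lemma del_edge_irrefl x : ~ del_edge_edge x x.
Proof. by move=> [xx _ _]; exact: edge_irrefl xx. Qed.

Lemma del_edge_vert x y : del_edge_edge x y -> vert G x.
Proof. by move=> [xy _ _]; apply: edge_vert xy. Qed.

Definition del_edge := Graph del_edge_sym del_edge_irrefl del_edge_vert.

End DelEdge.

(** One side of the cut is what u reaches without uv. A shortest path to v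
    there would close up through uv to a cycle. *)
Lemma acyclic_cut G u v : acyclic G -> edge G u v -> exists S, cuts G u v S.
Proof.
move=> aG uv; exists (linked (del_edge G u v) u); split.
- by apply: linked_refl; apply: edge_vert uv.
- move=> uv'; have [n duv] := linked_dist uv'.
  have [p [p0 pn ep injp _]] := geodesic duv.
  pose q i := if i <= n then p i else u.
  have n2 : 1 < n.
    case: n {duv q injp} pn ep => [|[|//]] pn ep.
      by case: (@edge_irrefl _ G u); rewrite -{2}p0 pn.
    by have [] := ep 0 isT; rewrite p0 pn => _ [].
  apply: (aG n.+1); apply: (@closed_path_cycle _ _ _ q) => //.
  + by rewrite /q ltnn p0.
  + move=> i; rewrite ltnS /q => le_in; rewrite le_in.
    case: ltnP => [lt_in|le_ni]; first by case: (ep i lt_in).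
    have -> : i = n by apply/eqP; rewrite eqn_leq le_in.
    by rewrite pn; apply: edge_sym.
  + by move=> i j lt_in lt_jn; rewrite /q -ltnS lt_in -ltnS lt_jn; apply: injp.
- move=> x y xy ux nuy; apply: contrapT => nxy; apply: nuy.
  have [[xv yu]|nyx] := pselect (x = v /\ y = u).
    by rewrite yu; apply: linked_refl; apply: edge_vert uv.
  by apply: linked_trans ux _; apply: linked_edge.
Qed.

(** A cycle leaves the cut set along one of its edges and can only come back
    along that same edge, which it does not use twice. *)
Lemma cut_acyclic G :
  (forall u v, edge G u v -> exists S, cuts G u v S) -> acyclic G.
Proof.
move=> cutG [|[|[|n]]] c [// _ injc ec].
have /cutG[S [Su Sv Scut]] := ec ord_max.
have c0 : ordS (ord_max : 'I_n.+3) = ord0 by apply/val_inj; rewrite /= modnn.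
rewrite c0 in Sv Scut.
suff out k (lt_k : k < n.+3) : ~ S (c (Ordinal lt_k)).
  by apply: (out n.+2 (ltnSn _)); rewrite (_ : Ordinal _ = ord_max) //; apply/val_inj.
elim: k lt_k => [|k IH] lt_k.
  by rewrite (_ : Ordinal _ = ord0) //; apply/val_inj.
have lt_k' := ltnW lt_k; move=> Sk; have := ec (Ordinal lt_k').
rewrite (_ : ordS _ = Ordinal lt_k); last by apply/val_inj; rewrite /= modn_small.
move=> kk; have [] := Scut _ _ (edge_sym kk) Sk (IH lt_k').
by move=> /injc/(congr1 val)/= [kE] /injc/(congr1 val)/=; rewrite kE.
Qed.

Lemma cut_walk G S n x y : walk G n x y -> S x -> ~ S y ->
  exists a b, [/\ edge G a b, S a & ~ S b].
Proof.
elim=> [//|{}n {}x z {}y _ IH zy] Sx nSy.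
by have [Sz|nSz] := pselect (S z); [exists z, y|apply: IH].
Qed.

Section Meet.
Variables A B : graph T.

Definition meet_edge x y := edge A x y /\ edge B x y.

Lemma meet_sym x y : meet_edge x y -> meet_edge y x.
Proof. by move=> [Axy Bxy]; split; apply: edge_sym. Qed.

Lemma meet_irrefl x : ~ meet_edge x x.
Proof. by move=> [xx _]; exact: edge_irrefl xx. Qed.

Lemma meet_vert x y : meet_edge x y -> (vert A `&` vert B) x.
Proof. by move=> [Axy Bxy]; split; [apply: edge_vert Axy|apply: edge_vert Bxy]. Qed.

Definition meet := Graph meet_sym meet_irrefl meet_vert.

End Meet.

(** The last edge yz of a geodesic of A between two vertices of the meet is cut
    off in C, and the rest of the geodesic stays on the side of y. A walk in B
    between the same ends must cross the cut, so it uses yz; then y is in the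
    meet too, and is closer. *)
Lemma meet_connected A B C : acyclic C -> subgraph A C -> subgraph B C ->
  connected A -> connected B -> connected (meet A B).
Proof.
move=> aC sA sB cA cB w z [Aw Bw] [Az Bz].
have [d] := linked_dist (cA w z Aw Az).
elim: d z Az Bz => [|d IH] z Az Bz [wz min].
  by inversion wz; subst; exists 0; apply: walk0.
inversion wz as [|n w' y z' wy yz]; subst.
have dy : is_dist A w y d.
  by split=> // n ny; rewrite -ltnS; apply: min; apply: walkS yz.
have [S [Sy Sz Scut]] := acyclic_cut aC (sA.2 _ _ yz).
(* the geodesic meets z only at its end, so it crosses the cut only there *)
have Sw : S w.
  apply: contrapT => nSw.
  suff /(_ d y (leqnn d) wy) : forall k t, k <= d -> walk A k w t -> ~ S t by [].
  move=> k t le_kd wt.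
  elim: wt nSw le_kd min {wz wy dy Aw Bw IH} => [//|{}k {}w s {}t ws IH st].
  move=> nSw le_kd min St; have nSs := IH nSw (ltnW le_kd) min.
  have [_ sz] := Scut _ _ (sA.2 _ _ (edge_sym st)) St nSs.
  by have := min k; rewrite -sz => /(_ ws); lia.
have [m wzB] := cB w z Bw Bz.
have [a [b [ab Sa nSb]]] := cut_walk wzB Sw Sz.
have [aE bE] := Scut _ _ (sB.2 _ _ ab) Sa nSb; subst a b.
have [k wyM] := IH y (edge_vert yz) (edge_vert ab) dy.
by exists k.+1; apply: walkS wyM _.
Qed.

(** Along an edge of the meet both cut sets change at the same time, namely
    exactly when the edge is uv. *)
Lemma cuts_agree A B S S' u v x y : cuts A u v S -> cuts B u v S' ->
  linked (meet A B) x y -> (S x <-> S' x) -> (S y <-> S' y).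
Proof.
move=> [Su Sv cS] [S'u S'v cS'] [n]; elim=> [//|{}n {}x z {}y _ IH [Azy Bzy]].
move=> /IH Sz; have := cS _ _ Azy; have := cS _ _ (edge_sym Azy).
have := cS' _ _ Bzy; have := cS' _ _ (edge_sym Bzy).
have E (P : Prop) : (P -> False) \/ P by case: (pselect P) => ?; [right|left].
case: (E (S z)) (E (S y)) (E (S' y)) => ? [] ? [] ?; intuition; subst; tauto.
Qed.

(** A cut of uv in the union is obtained by gluing cuts of A and B that agree on
    the meet. *)
Lemma acyclic_glue A B C : acyclic A -> acyclic B -> connected (meet A B) ->
  (forall x y, edge C x y -> edge A x y \/ edge B x y) -> acyclic C.
Proof.
have half A' B' u v : acyclic A' -> acyclic B' -> connected (meet A' B') ->
    edge A' u v -> exists S, [/\ S u, ~ S v &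
      forall x y, edge A' x y \/ edge B' x y -> S x -> ~ S y -> x = u /\ y = v].
  move=> aA aB cM uv; have [S cS] := acyclic_cut aA uv.
  have [S' [agree cS']] : exists S',
      (forall x, vert A' x -> vert B' x -> (S x <-> S' x)) /\
      forall x y, edge B' x y -> S' x -> ~ S' y -> x = u /\ y = v.
    (* if uv is not in B, the cut of A is constant on the meet, and this constant
       extends over B *)
    have [uvB|nuvB] := pselect (edge B' u v).
      have [S' cS'] := acyclic_cut aB uvB; exists S'; split; last by case: cS'.
      have Mu : vert (meet A' B') u by split; [apply: edge_vert uv|apply: edge_vert uvB].
      move=> x Ax Bx; apply: (cuts_agree cS cS' (cM u x Mu (conj Ax Bx))).
      by case: cS cS' => ? _ _ [].
    exists [set _ | exists x, [/\ vert A' x, vert B' x & S x]]; split=> //.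
    move=> x Ax Bx; split=> [Sx|[y [Ay By Sy]]]; first by exists x.
    have [n] := cM y x (conj Ay By) (conj Ax Bx).
    apply: contraPP => nSx /cut_walk/(_ Sy nSx)[a [b [[Aab Bab] Sa nSb]]].
    by have [_ _ /(_ _ _ Aab Sa nSb)[aE bE]] := cS; subst.
  exists [set x | (vert A' x /\ S x) \/ (vert B' x /\ S' x)]; case: cS => Su nSv cS.
  split=> [||x y xy].
  - by left; split=> //; apply: edge_vert uv.
  - case=> [[]//|[Bv S'v]]; apply: nSv; apply/agree => //; exact: edge_vertr uv.
  - case: xy => xy; have Vx := edge_vert xy; have Vy := edge_vertr xy; move=> Sx nSy.
      apply: cS => //; last by move=> Sy; apply: nSy; left.
      by case: Sx => [[]//|[Bx S'x]]; apply/agree.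
    apply: cS' => //; last by move=> Sy; apply: nSy; right.
    by case: Sx => [[Ax Sx]|[]//]; apply/agree.
move=> aA aB cM sC; apply: cut_acyclic => u v /sC[] uv.
  have [S [Su nSv cS]] := half A B u v aA aB cM uv.
  by exists S; split=> // x y /sC; apply: cS.
have cM' : connected (meet B A).
  move=> x y [Bx Ax] [By Ay]; apply: linked_sub (cM x y (conj Ax Bx) (conj Ay By)).
  by split=> [? []|? ? []].
have [S [Su nSv cS]] := half B A u v aB aA cM' uv.
by exists S; split=> // x y /sC xy; apply: cS; tauto.
Qed.

End Cuts.

(** * Induced subgraphs and distance layers *)

Section Induced.
Context {T : Type} (G : graph T) (S : set T).

Definition induced_edge x y := [/\ S x, S y & edge G x y].

Lemma induced_sym x y : induced_edge x y -> induced_edge y x.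
Proof. by move=> [Sx Sy xy]; split=> //; apply: edge_sym. Qed.

Lemma induced_irrefl x : ~ induced_edge x x.
Proof. by move=> [_ _ xx]; exact: edge_irrefl xx. Qed.

Lemma induced_vert x y : induced_edge x y -> (S `&` vert G) x.
Proof. by move=> [Sx _ xy]; split=> //; apply: edge_vert xy. Qed.

Definition induced := Graph induced_sym induced_irrefl induced_vert.

End Induced.

Section InducedTheory.
Context {T : Type} (G : graph T).
Implicit Types (Y : set T) (u v x y : T).

Definition nbrs x Y : set T := [set y | Y y /\ edge G x y].

Lemma connected_root (K : graph T) u :
  (forall v, vert K v -> linked K v u) -> connected K.
Proof.
by move=> Ku v w /Ku vu /Ku wu; apply: linked_trans vu (linked_sym wu).
Qed.

Lemma induced_subgraph Y Y' : Y `<=` Y' -> subgraph (induced G Y) (induced G Y').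
Proof. by move=> sY; split=> [x [/sY ? ?]|x y [/sY ? /sY ? ?]]; split. Qed.

Lemma connected_add Y x y : connected (induced G Y) -> Y y -> edge G y x ->
  connected (induced G (Y `|` [set x])).
Proof.
move=> cY Yy yx; apply: (@connected_root _ y) => z [Yz Gz].
have Gy := edge_vert yx; case: Yz => [Yz|->].
  apply: linked_sub (cY z y (conj Yz Gz) (conj Yy Gy)).
  by apply: induced_subgraph => ?; left.
by apply: linked_edge; split; [right|left|apply: edge_sym].
Qed.

Lemma connected_induced1 x : connected (induced G [set x]).
Proof.
by apply: (@connected_root _ x) => y [-> Gx]; apply: linked_refl.
Qed.

Lemma connected_induced_path (p : nat -> T) n :
  (forall i, i < n -> p i = p i.+1 \/ edge G (p i) (p i.+1)) ->
  connected (induced G (p @` `I_n.+1)).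
Proof.
elim: n => [|n IH] ep.
  have -> : p @` `I_1 = [set p 0].
    by apply/seteqP; split=> [_ [[|//] _ <-]|_ ->]; last exists 0.
  exact: connected_induced1.
have -> : p @` `I_n.+2 = p @` `I_n.+1 `|` [set p n.+1].
  by rewrite IIS image_setU image_set1.
have Yn : (p @` `I_n.+1) (p n) by exists n => //=.
have cY := IH (fun i lt_in => ep i (ltnW lt_in)).
case: (ep n (ltnSn n)) => [<-|]; last exact: connected_add.
by rewrite (_ : _ `|` _ = p @` `I_n.+1) //; apply: setUidl => _ ->.
Qed.

Lemma card_add (X : set T) x n :
  (X #<= `I_n)%card -> (X `|` [set x] #<= `I_n.+1)%card.
Proof.
move=> Xn; pose q (g : nat -> T) i := if i < n then g i else x.
suff [g sX] : exists g, X `|` [set x] `<=` q g @` `I_n.+1.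
  exact: card_le_trans (subset_card_le sX) (card_image_le _ _).
case: (pfcard_geP Xn) => [->|[g]].
  by exists (fun=> x) => y [//|->]; exists n; rewrite /q /= ?ltnn.
exists g => y [Xy|->]; last by exists n; rewrite /q /= ?ltnn.
have [i /= lt_in <-] := 'surj_g Xy.
by exists i; rewrite /q /= ?lt_in // ltnS ltnW.
Qed.

Lemma card_set1_le x : ([set x] #<= `I_1)%card.
Proof. by rewrite -[[set x]]set0U; apply: card_add; apply: card_ge0. Qed.

Lemma dist_pred v x d : is_dist G v x d.+1 ->
  exists2 y, is_dist G v y d & edge G y x.
Proof.
move=> [vx min]; inversion vx as [|n v' y x' vy yx]; subst.
by exists y => //; split=> // n ny; rewrite -ltnS; apply: min; apply: walkS yx.
Qed.

Lemma dist_edge v x y d e :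
  is_dist G v x d -> is_dist G v y e -> edge G x y -> e <= d.+1.
Proof. by move=> [vx _] [_ min] xy; apply: min; apply: walkS xy. Qed.

Lemma dist0 v y : is_dist G v y 0 -> y = v.
Proof. by move=> [w _]; inversion w. Qed.

Lemma dist_inj v x d e : is_dist G v x d -> is_dist G v x e -> d = e.
Proof.
by move=> [w m] [w' m']; apply/eqP; rewrite eqn_leq (m _ w') (m' _ w).
Qed.

(** A geodesic from v in Y costs only one new vertex per level, since v itself
    is already counted. *)
Lemma attach_geodesic (Y : set T) m v z k :
    connected (induced G Y) -> Y `<=` vert G -> Y v -> (Y #<= `I_m)%card ->
    is_dist G v z k ->
  exists S : set T,
    [/\ Y `<=` S, S z, S `<=` vert G, connected (induced G S) &
        (S #<= `I_(m + k))%card /\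
        forall s, S s -> [\/ Y s, s = z | exists2 j, j < k & is_dist G v s j]].
Proof.
move=> cY GY Yv cardY; elim: k z => [|k IH] z dz.
  exists Y; rewrite addn0 (dist0 dz); split=> //; split=> // s; exact: Or31.
have [y dy yz] := dist_pred dz.
have [S [YS Sy GS cS [cardS distS]]] := IH y dy.
exists (S `|` [set z]); split.
- by move=> s /YS; left.
- by right.
- by move=> s [/GS//|->]; apply: edge_vertr yz.
- exact: connected_add cS Sy yz.
- split=> [|s [/distS[Ys|->|[j ltj js]]|->]].
  + by rewrite addnS; apply: card_add.
  + exact: Or31.
  + by apply: Or33; exists k.
  + by apply: Or33; exists j => //; apply: ltnW.
  + exact: Or32.
Qed.

(** The count 2d + 1 is what makes the bounds on r in the two lemmas about
    lower neighbours sharp enough: the geodesics share v. *)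
Lemma two_geodesics v y z d : is_dist G v y d -> is_dist G v z d ->
  exists S : set T,
    [/\ S y, S z, S `<=` vert G, connected (induced G S) &
        (S #<= `I_(d.*2.+1))%card /\
        forall s, S s -> [\/ s = y, s = z | exists2 j, j < d & is_dist G v s j]].
Proof.
move=> dy dz; have Gv := walk_vertl dy.1.
have [|S1 [vS1 S1y GS1 cS1 [card_S1 dist_S1]]] :=
  attach_geodesic (@connected_induced1 v) _ (erefl v) (card_set1_le v) dy.
  by move=> _ ->.
have [S [S1S Sz GS cS [cardS distS]]] :=
  attach_geodesic cS1 GS1 (vS1 _ (erefl v)) card_S1 dz.
exists S; split=> //; first exact: S1S.
split=> [|s]; first by rewrite -addnn -add1n addnA.
case/distS=> [/dist_S1[->|->|[j]]|->|[j]]; last 4 first.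
- exact: Or31.
- by move=> ltj js; apply: Or33; exists j.
- exact: Or32.
- by move=> ltj js; apply: Or33; exists j.
case: d dy dz {card_S1 dist_S1 cardS distS} => [dy _|d dy dz].
  by apply: Or31; rewrite (dist0 dy).
by apply: Or33; exists 0 => //; split=> //; apply: walk0.
Qed.

End InducedTheory.

(** * Acyclic unions of regions *)

Section Representation.
Context {V W : Type} (G : graph V) (H : graph W) (R : V -> graph W).
Hypothesis hR : region_representation G H R.
Hypothesis h3 : k_acyclic G R 3.
Implicit Types (x y z : V) (X Y S : set V).

Local Notation U := (graph_union R).
Local Notation GI := (induced G).
Local Notation N := (nbrs G).

Lemma region_connected x : vert G x -> connected (R x).
Proof. by move=> /hR.1[]. Qed.

Lemma edge_meet x y : edge G x y -> exists a, vert (R x) a /\ vert (R y) a.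
Proof.
move=> xy; have [_ hE] := hR.
have nxy : x <> y by move=> E; apply: (@edge_irrefl _ G x); rewrite {2}E.
by case/(hE x y (edge_vert xy) (edge_vertr xy) nxy): xy => a; exists a.
Qed.

Lemma meet_edge_rep x y a : vert G x -> vert G y -> x <> y ->
  vert (R x) a -> vert (R y) a -> edge G x y.
Proof. by move=> Gx Gy nxy xa ya; apply/hR.2 => //; exists a. Qed.

Lemma union_subgraph X Y : X `<=` Y -> subgraph (U X) (U Y).
Proof.
by move=> sXY; split=> [a [x /sXY Yx xa]|a b [x /sXY Yx xab]]; exists x.
Qed.

Lemma region_subgraph X x : X x -> subgraph (R x) (U X).
Proof. by move=> Xx; split=> [a xa|a b xab]; exists x. Qed.

Lemma acyclic_union_sub X Y : X `<=` Y -> acyclic (U Y) -> acyclic (U X).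
Proof. by move=> /union_subgraph[_ sE]; apply: acyclic_sub. Qed.

(** Walks in G lift to walks through the regions, since adjacent vertices have
    meeting regions. *)
Lemma union_connected X : X `<=` vert G -> connected (GI X) -> connected (U X).
Proof.
move=> GX cX a b [x Xx xa] [y Xy yb].
have [n] := cX x y (conj Xx (GX x Xx)) (conj Xy (GX y Xy)).
have inR z c d : X z -> vert (R z) c -> vert (R z) d -> linked (U X) c d.
  move=> Xz zc zd; apply: linked_sub (region_connected (GX z Xz) zc zd).
  exact: region_subgraph.
move=> w; elim: w xa b Xy yb {Xx} => [z _ za b Xz|]; first exact: inR.
move=> {}n {}x t z _ IH [Xt _ tz] xa b Xz zb.
have [c [tc zc]] := edge_meet tz.
by apply: linked_trans (IH xa c Xt tc) (inR z c b Xz zc zb).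
Qed.

(** R_x and the union of R_y and R_z are connected subgraphs of the union of the
    three regions, which is a forest, so they meet in a connected graph. This
    replaces the Helly property of subtrees. *)
Lemma spoke_linked x Y y z a b : Y y -> Y z -> edge G x y -> edge G x z ->
    y = z \/ edge G y z ->
    vert (R x) a -> vert (R y) a -> vert (R x) b -> vert (R z) b ->
  linked (meet (R x) (U Y)) a b.
Proof.
move=> Yy Yz xy xz yz xa ya xb zb.
have Gx := edge_vert xy; have Gy := edge_vertr xy; have Gz := edge_vertr xz.
pose P : set V := [set y] `|` [set z].
have GP : P `<=` vert G by move=> _ [->|->].
have cP : connected (GI P).
  case: yz => [yz|yz]; last exact: connected_add (@connected_induced1 _ _ _) _ yz.
  by rewrite /P yz setUid; apply: connected_induced1.
have acU : acyclic (U (P `|` [set x])).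
  apply: h3 => [v [/GP//|->//]|]; do 2![apply: card_add].
  exact: card_set1_le.
have cM : connected (meet (R x) (U P)).
  apply: meet_connected acU _ _ (region_connected Gx) (union_connected GP cP).
    by apply: region_subgraph; right.
  by apply: union_subgraph => ?; left.
have sM : subgraph (meet (R x) (U P)) (meet (R x) (U Y)).
  have [sV sE] : subgraph (U P) (U Y) by apply: union_subgraph => _ [->|->].
  by split=> [c [? /sV]|c d [? /sE]].
apply: linked_sub sM (cM a b _ _); split=> //; first by exists y => //; left.
by exists z => //; right.
Qed.

Lemma acyclic_union1 x : vert G x -> acyclic (U [set x]).
Proof.
move=> Gx; apply: h3 => [_ -> //|]; apply: card_le_trans (card_set1_le x) _.
by rewrite card_le_II.
Qed.

(** A walk among the neighbours of x in Y lifts, edge by edge, to a walk in the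
    meet of R_x and U_Y, so that R_x can be glued to U_Y. *)
Lemma acyclic_union_add x Y : vert G x -> Y `<=` vert G -> ~ Y x ->
  acyclic (U Y) -> connected (GI (N x Y)) -> acyclic (U (Y `|` [set x])).
Proof.
move=> Gx GY nYx aY cN.
have aRx : acyclic (R x).
  by apply: acyclic_sub (acyclic_union1 Gx) => a b ab; exists x.
apply: acyclic_glue aY aRx _ _; last first.
  by move=> a b [y [Yy yab|-> xab]]; [left; exists y|right].
have adj y a : Y y -> vert (R x) a -> vert (R y) a -> edge G x y.
  move=> Yy xa ya; apply: meet_edge_rep xa ya => //; first exact: GY.
  by move=> E; apply: nYx; rewrite E.
suff cM : connected (meet (R x) (U Y)).
  move=> a b [Ya xa] [Yb xb]; apply: linked_sub (cM a b _ _) => //.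
  by split=> [c [? ?]|c d [? ?]].
move=> a b [xa [y Yy ya]] [xb [z Yz zb]].
have xy := adj y a Yy xa ya; have xz := adj z b Yz xb zb.
have [n w] := cN y z (conj (conj Yy xy) (edge_vertr xy))
  (conj (conj Yz xz) (edge_vertr xz)).
elim: w ya b xb zb {Yy xy Yz xz} => [t [[Yt xt] _] ta b xb tb|].
  by apply: (@spoke_linked x Y t t) => //; left.
move=> {}n {}y t {}z _ IH [[Yt xt] [Yz xz] tz] ya b xb zb.
have [c [xc tc]] := edge_meet xt.
apply: linked_trans (IH ya c xc tc) _.
by apply: (@spoke_linked x Y t z) => //; right.
Qed.

(** Conversely, R_x and U_Y meet in a connected graph. A walk there runs through
    regions of neighbours of x, and consecutive ones share a vertex of W, hence
    are equal or adjacent. *)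
Lemma nbrs_connected_of_acyclic x Y : vert G x -> Y `<=` vert G -> ~ Y x ->
  acyclic (U (Y `|` [set x])) -> connected (GI Y) -> connected (GI (N x Y)).
Proof.
move=> Gx GY nYx aU cY.
have cM : connected (meet (R x) (U Y)).
  apply: meet_connected aU _ _ (region_connected Gx) (union_connected GY cY).
    by apply: region_subgraph; right.
  by apply: union_subgraph => ?; left.
have adj y a : Y y -> vert (R x) a -> vert (R y) a -> edge G x y.
  move=> Yy xa ya; apply: meet_edge_rep xa ya => //; first exact: GY.
  by move=> E; apply: nYx; rewrite E.
move=> y z [[Yy xy] Gy] [[Yz xz] Gz].
have [a [xa ya]] := edge_meet xy; have [b [xb zb]] := edge_meet xz.
have near s t c : Y s -> Y t -> vert (R x) c -> vert (R s) c -> vert (R t) c ->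
    linked (GI (N x Y)) s t.
  move=> Ys Yt xc sc tc; have xs := adj s c Ys xc sc; have xt := adj t c Yt xc tc.
  have [->|nst] := pselect (s = t).
    by apply: linked_refl; split=> //; apply: GY.
  apply: linked_edge; split=> //.
  by apply: (meet_edge_rep _ _ nst sc tc); apply: GY.
have [n] := cM a b (conj xa (ex_intro2 _ _ y Yy ya)) (conj xb (ex_intro2 _ _ z Yz zb)).
move=> w; elim: w ya z Yz xz Gz zb {xa xb}.
  by move=> c [xc _] yc z Yz xz Gz zc; apply: near zc.
move=> {}n {}a c {}b _ IH [xcb [s Ys scb]] ya z Yz xz Gz zb.
have xc := edge_vert xcb; have sc := edge_vert scb; have xs := adj s c Ys xc sc.
apply: linked_trans (IH ya s Ys xs (GY s Ys) sc) _.
exact: near (edge_vertr xcb) (edge_vertr scb) zb.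
Qed.

(** A cycle uses one region per edge, and the regions of consecutive edges
    share a vertex. So acyclicity of an arbitrary union only concerns the
    vertices of finite walks in G. *)
Lemma acyclic_union_walks X : X `<=` vert G ->
    (forall f n, (forall i, X (f i)) ->
      (forall i, i < n -> f i = f i.+1 \/ edge G (f i) (f i.+1)) ->
      acyclic (U (f @` `I_n.+1))) ->
  acyclic (U X).
Proof.
move=> GX aX [|[|[|n]]] c [// _ injc ec].
have [f fE] := choice (fun i => let: ex_intro2 x Xx xi := ec i in
  ex_intro (fun x => X x /\ edge (R x) (c i) (c (ordS i))) x (conj Xx xi)).
pose g i := f (inord i : 'I_n.+3).
apply: (aX g n.+2 _ _ _ c).
- by move=> i; case: (fE (inord i)).
- move=> i lt_i; have [E|nE] := pselect (g i = g i.+1); [by left|right].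
  have [Xi ei] := fE (inord i); have [Xi' ei'] := fE (inord i.+1).
  apply: (meet_edge_rep (GX _ Xi) (GX _ Xi') nE _ (edge_vert ei')).
  suff <- : ordS (inord i : 'I_n.+3) = inord i.+1 by apply: edge_vertr ei.
  by apply: val_inj; rewrite /= !inordK ?modn_small // ltnS ltnW.
split=> // i; exists (f i); last by case: (fE i).
by exists i; rewrite /= /g ?inord_val.
Qed.

(** * Unions of distance layers *)

Section Layers.
Variables (r : nat) (v : V).
Hypothesis hr : k_acyclic G R r.

(** The ends y and z, their geodesics to v and the vertex x span at most
    2d + 2 vertices, on which the neighbours of x are just y and z. *)
Lemma lower_nbrs_adjacent x y z d : d.*2.+2 <= r -> is_dist G v x d.+1 ->
  is_dist G v y d -> is_dist G v z d -> edge G x y -> edge G x z -> y <> z ->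
  edge G y z.
Proof.
move=> le_r dx dy dz xy xz nyz.
have [S [Sy Sz GS cS [cardS distS]]] := two_geodesics dy dz.
have Gx := edge_vert xy.
have nSx : ~ S x.
  move=> /distS[E|E|[j lt_j dj]]; try subst x.
  - by have := dist_inj dx dy; lia.
  - by have := dist_inj dx dz; lia.
  - by have := dist_inj dx dj; lia.
have aU : acyclic (U (S `|` [set x])).
  apply: hr => [s [/GS|->]//|]; apply: card_le_trans (card_add _ cardS) _.
  by rewrite card_le_II.
have cN := nbrs_connected_of_acyclic Gx GS nSx aU cS.
have [w [_ [Sw xw] yw]] := connected_nbr cN (conj (conj Sy xy) (GS y Sy))
  (conj (conj Sz xz) (GS z Sz)) nyz.
case/distS: Sw yw => [->|-> //|[j lt_j dj]] yw.
  by have := edge_irrefl yw.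
by have := dist_edge dj dx (edge_sym xw); lia.
Qed.

(** Here y is put together with two geodesics from v to lower neighbours of x
    and of y. Among the at most 2d + 2 vertices obtained, y and the lower
    neighbour of x are neighbours of x, so y is adjacent to another one, which
    can only be at level d. *)
Lemma common_lower_nbr x y d : d.*2.+3 <= r -> is_dist G v x d.+1 ->
  is_dist G v y d.+1 -> edge G x y ->
  exists z, [/\ is_dist G v z d, edge G x z & edge G y z].
Proof.
move=> le_r dx dy xy.
have [x' dx' xx'] := dist_pred dx; have [y' dy' yy'] := dist_pred dy.
have [S [Sx' Sy' GS cS [cardS distS]]] := two_geodesics dx' dy'.
have Slow s : S s -> exists2 j, j <= d & is_dist G v s j.
  by case/distS=> [->|->|[j /ltnW]]; [exists d|exists d|exists j].
have nSx : ~ S x by move=> /Slow[j le_j dj]; have := dist_inj dx dj; lia.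
have nSy : ~ S y by move=> /Slow[j le_j dj]; have := dist_inj dy dj; lia.
pose Y := S `|` [set y].
have Gx := edge_vert xy; have Gy := edge_vertr xy.
have GY : Y `<=` vert G by move=> s [/GS|->].
have nYx : ~ Y x by case=> // E; apply: (@edge_irrefl _ G x); rewrite {2}E.
have cY : connected (GI Y) by apply: connected_add cS Sy' yy'.
have aU : acyclic (U (Y `|` [set x])).
  apply: hr => [s [/GY|->]//|]; apply: card_le_trans (card_add x (card_add y cardS)) _.
  by rewrite card_le_II.
have cN := nbrs_connected_of_acyclic Gx GY nYx aU cY.
have Ny : vert (GI (N x Y)) y by do 2?split=> //; right.
have Nx' : vert (GI (N x Y)) x'.
  by do 2?split; [left|apply: edge_sym|apply: edge_vert xx'].
have nyx' : y <> x' by move=> E; apply: nSy; rewrite E.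
have [w [_ [[Sw|->] xw] yw]] := connected_nbr cN Ny Nx' nyx'; last first.
  by have := edge_irrefl yw.
exists w; split=> //; have [j le_j dj] := Slow w Sw.
suff <- : j = d by [].
by have := dist_edge dj dx (edge_sym xw); lia.
Qed.

Definition layers d : set V := [set x | exists2 k, k <= d & walk G k v x].

Lemma layersP x d : layers d x <-> exists2 k, k <= d & is_dist G v x k.
Proof.
split=> [[k le_kd vx]|[k le_kd [vx _]]]; last by exists k.
have [e de le_ek] := dist_le vx.
by exists e => //; apply: leq_trans le_ek le_kd.
Qed.

Lemma layers_vert d : layers d `<=` vert G.
Proof. by move=> x [k _ vx]; apply: walk_vertr vx. Qed.

(** When x of level d + 1 is added, its neighbours of level d form a clique, and
    each neighbour of level d + 1 is adjacent to one of them. *)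
Lemma acyclic_union_layers d : vert G v -> d.*2 < r -> acyclic (U (layers d)).
Proof.
move=> Gv; elim: d => [|d IH] le_r.
  apply: acyclic_union_sub (acyclic_union1 Gv) => x [[|//] _ vx].
  by inversion vx.
have aD := IH (ltn_trans (ltnSn _) (ltnW le_r)).
apply: acyclic_union_walks (@layers_vert _) _ => f n Xf _.
suff aDf m : acyclic (U (layers d `|` f @` `I_m)).
  by apply: acyclic_union_sub (aDf n.+1) => x; right.
elim: m => [|m IHm]; first by rewrite II0 image_set0 setU0.
rewrite IIS image_setU image_set1 setUA.
set Y := _ `|` _ in IHm *; set x := f m.
have [Yx|nYx] := pselect (Y x); first by rewrite setUidl // => _ ->.
have Gx : vert G x := layers_vert (Xf m).
have GY : Y `<=` vert G.
  by move=> s [/layers_vert//|[i _ <-]]; apply: layers_vert (Xf i).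
have dx : is_dist G v x d.+1.
  have /layersP[k le_k dk] := Xf m.
  suff -> : d.+1 = k by [].
  apply/eqP; rewrite eqn_leq le_k andbT ltnNge; apply/negP => le_kd.
  by apply: nYx; left; apply/layersP; exists k.
apply: acyclic_union_add => //.
have [q dq qx] := dist_pred dx; have xq := edge_sym qx.
have Dq : layers d q by apply/layersP; exists d.
have low s : layers d s -> edge G x s -> linked (GI (N x Y)) s q.
  move=> Ds xs; have /layersP[k le_k dk] := Ds.
  have kE : k = d by have := dist_edge dk dx (edge_sym xs); lia.
  rewrite {}kE in dk.
  have [->|nsq] := pselect (s = q).
    by apply: linked_refl; split; [split=> //; left|apply: edge_vertr xq].
  apply: linked_edge; split; [by split=> //; left|by split=> //; left|].
  by apply: lower_nbrs_adjacent dx dk dq xs xq nsq; rewrite -doubleS ltnW.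
apply: (@connected_root _ _ q) => s [[Ys xs] Gs].
have [Ds|nDs] := pselect (layers d s); first exact: low.
have ds : is_dist G v s d.+1.
  case: Ys => // -[i _ fis]; have /layersP[k le_k dk] := Xf i.
  rewrite fis in dk.
  suff -> : d.+1 = k by [].
  apply/eqP; rewrite eqn_leq le_k andbT ltnNge; apply/negP => le_kd.
  by apply: nDs; apply/layersP; exists k.
have [z [dz xz sz]] := common_lower_nbr le_r dx ds xs.
have Dz : layers d z by apply/layersP; exists d.
apply: linked_trans (low z Dz xz).
by apply: linked_edge; split=> //; split=> //; left.
Qed.

End Layers.

(** * The two implications *)

Lemma locally_chordal_of_acyclic r :
  3 < r -> k_acyclic G R r -> locally_chordal r G.
Proof.
move=> r3 hr v Gv [|[|[|[|n]]]] c // _ cyc; have [_ injc ec] := cyc.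
have level i : exists2 d, is_dist G v (c i) d & d.*2 <= r := edge_vert (ec i).
have [[i [d di dr]]|low] := pselect (exists i, exists2 d, is_dist G v (c i) d & d.*2 = r).
  (* edges between two vertices of level r/2 are not in the ball, so both cycle
     neighbours of c i lie one level lower *)
  have [d' dE] : exists d', d = d'.+1 by case: d dr {di} => [|d'] ?; [lia|exists d'].
  subst d.
  have up j : edge (half_ball G r v) (c i) (c j) -> is_dist G v (c j) d'.
    move=> [cij [e [e' [de de' lt_r]]]].
    have eE := dist_inj di de; have := dist_edge de' di (edge_sym cij).
    by move=> le_e; suff <- : e' = d' by []; lia.
  pose j := ord_pred i; have ji : ordS j = i by rewrite /j ord_predK.
  have eij : edge (half_ball G r v) (c i) (c j).
    by have := ec j; rewrite ji; apply: edge_sym.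
  have dj := up _ eij; have dk := up _ (ec i).
  apply: (@chord_skipping_one _ _ _ _ j) => //; rewrite ji; split; last first.
    by exists d', d'; split=> //; lia.
  apply: (lower_nbrs_adjacent hr _ di dj dk eij.1 (ec i).1); first lia.
  rewrite -ji => /injc/(congr1 (@nat_of_ord n.+4)).
  by case: (ordS_cases j) (ordS_cases (ordS j)) => [[? ?]|[? ?]] [[? ?]|[? ?]]; lia.
(* all levels are below r/2, where every edge of G belongs to the ball; the
   criterion is applied to c 0 and the path formed by the other vertices *)
pose D := r.-1./2.
have lowD i : layers v D (c i).
  have [d di le_r] := level i; apply/layersP; exists d => //.
  have ne : d.*2 <> r by move=> E; apply: low; exists i, d.
  by rewrite /D; lia.
have ball_edge i j : edge G (c i) (c j) -> edge (half_ball G r v) (c i) (c j).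
  move=> cij; split=> //; have /layersP[a le_a da] := lowD i.
  have /layersP[b le_b db] := lowD j; exists a, b; split=> //.
  by rewrite /D in le_a le_b; lia.
pose p k := c (inord k.+1).
pose Y := p @` `I_n.+3; pose x := c ord0.
have succ k : k < n.+3 -> ordS (inord k : 'I_n.+4) = inord k.+1.
  by move=> lt_k; apply: val_inj; rewrite /= !inordK ?modn_small // ltnW.
have sYD : Y `|` [set x] `<=` layers v D by move=> s [[k _ <-]|->]; apply: lowD.
have GY : Y `<=` vert G by move=> s Ys; apply: (@layers_vert v D); apply: sYD; left.
have Gx : vert G x by apply: (@layers_vert v D); apply: lowD.
have nYx : ~ Y x.
  by move=> [k /= lt_k /injc/(congr1 val)/=]; rewrite inordK.
have aU : acyclic (U (Y `|` [set x])).
  by apply: acyclic_union_sub sYD (acyclic_union_layers hr Gv _); rewrite /D; lia.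
have cY : connected (GI Y).
  apply: connected_induced_path => k lt_k; right.
  by rewrite /p -(succ k.+1) //; apply: (ec _).1.
have cN := nbrs_connected_of_acyclic Gx GY nYx aU cY.
have S0 : ordS (ord0 : 'I_n.+4) = inord 1 by apply: val_inj; rewrite /= inordK.
have Smax : ordS (ord_max : 'I_n.+4) = ord0 by apply: val_inj; rewrite /= modnn.
have x1 : edge G x (c (inord 1)) by have := (ec ord0).1; rewrite S0.
have xmax : edge G x (c ord_max).
  by apply: edge_sym; have := (ec ord_max).1; rewrite Smax.
have Y1 : Y (c (inord 1)) by exists 0.
have Ymax : Y (c ord_max).
  by exists n.+2 => //=; rewrite /p; congr c; apply: val_inj; rewrite /= inordK.
have nmax1 : c ord_max <> c (inord 1).
  by move=> /injc/(congr1 val)/=; rewrite inordK.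
have [w [_ [[k lt_k <-] xw] mw]] := connected_nbr cN (conj (conj Ymax xmax) (GY _ Ymax))
  (conj (conj Y1 x1) (GY _ Y1)) nmax1.
have [k0|k_gt0] := posnP k.
  apply: (@chord_skipping_one _ _ _ _ ord_max) => //; rewrite Smax S0; apply: ball_edge.
  by move: mw; rewrite /p k0.
have [kn|nkn] := eqVneq k n.+2.
  case: (@edge_irrefl _ G (c ord_max)); rewrite {2}(_ : ord_max = inord k.+1) //.
  by apply: val_inj; rewrite /= inordK // kn.
exists ord0, (inord k.+1); split; last exact: ball_edge.
- by apply/eqP => /(congr1 val); rewrite /= inordK.
- by rewrite S0; apply/eqP => /(congr1 val)/=; rewrite !inordK //=; lia.
- apply/eqP => /(congr1 val)/=; rewrite inordK // modn_small //.
  by rewrite /= in lt_k; lia.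
Qed.

(** Going around a cycle of length n <= r in both directions, the two ends of an
    edge have distances at most i and n - (i + 1) to the first vertex, and these
    add up to less than r. So the whole cycle
    lies in the ball around that vertex. *)
Lemma short_cycle_chord r n (p : nat -> V) :
    locally_chordal r G -> 4 <= n -> n <= r -> p n = p 0 ->
    (forall i, i < n -> edge G (p i) (p i.+1)) ->
    (forall i j, i < n -> j < n -> p i = p j -> i = j) ->
  has_chord G (fun i : 'I_n => p i).
Proof.
move=> lc n4 le_nr pn ep injp.
have Gp i : i <= n -> vert G (p i).
  rewrite leq_eqVlt => /predU1P[->|lt_in]; last exact: edge_vert (ep i lt_in).
  by rewrite pn; apply: edge_vert (ep 0 _); lia.
have seg i j : i <= j -> j <= n -> walk G (j - i) (p i) (p j).
  by move=> ij jn; apply: path_walk => // [|k k_ij]; [apply: Gp|apply: ep]; lia.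
have cyc : is_cycle (half_ball G r (p 0)) (fun i : 'I_n => p i).
  apply: closed_path_cycle => // [|i lt_in]; first exact: ltnW.
  split; first exact: ep.
  have [d dd le_d] := dist_le (seg 0 i (leq0n i) (ltnW lt_in)).
  have w := seg i.+1 n lt_in (leqnn n); rewrite pn in w.
  have [e de le_e] := dist_le (walk_sym w).
  by exists d, e; split=> //; lia.
have [i [j [? ? ? [eij _]]]] := lc _ (Gp 0 (leq0n n)) n _ n4 cyc.
by exists i, j.
Qed.

(** By induction on the length of a geodesic of G[Y] between neighbours a and b
    of x: it can be split at an inner vertex adjacent to x, and without such a
    vertex it has length at most 1, for otherwise it forms with x a chordless
    cycle with at most r vertices. *)
Lemma nbrs_connected_of_locally_chordal r x Y :
  locally_chordal r G -> vert G x -> Y `<=` vert G -> ~ Y x ->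
  connected (GI Y) -> (Y `|` [set x] #<= `I_r)%card ->
  connected (GI (N x Y)).
Proof.
move=> lc Gx GY nYx cY cardY.
suff key m a b : N x Y a -> N x Y b -> walk (GI Y) m a b -> linked (GI (N x Y)) a b.
  move=> a b [Na Ga] [Nb Gb].
  have [m ab] := cY a b (conj Na.1 Ga) (conj Nb.1 Gb); exact: key ab.
elim/ltn_ind: m a b => m IH a b Na Nb ab.
have [d dab le_d] := dist_le ab; have [lt_d|ge_d] := ltnP d m.
  by apply: IH lt_d a b Na Nb dab.1.
have {ge_d le_d}dE : d = m by lia.
subst d.
have [p [p0 pm ep injp indp]] := geodesic dab.
have Yp i : i <= m -> Y (p i).
  rewrite leq_eqVlt => /predU1P[->|/ep[]//]; by rewrite pm; case: Nb.
have [[i /andP[i_gt0 lt_im] xi]|inner] := pselect (exists2 i, 0 < i < m & edge G x (p i)).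
  have Ni : N x Y (p i) by split=> //; apply: Yp; apply: ltnW.
  have seg j k : j <= k -> k <= m -> walk (GI Y) (k - j) (p j) (p k).
    move=> le_jk le_km; apply: path_walk => // [|l l_jk]; last by apply: ep; lia.
    have Yj : Y (p j) by apply: Yp; lia.
    by split=> //; apply: GY.
  have := seg 0 i (leq0n i) (ltnW lt_im); rewrite p0 => ai.
  have := seg i m (ltnW lt_im) (leqnn m); rewrite pm => ib.
  apply: linked_trans (IH _ _ _ _ Na Ni ai) (IH _ _ _ _ Ni Nb ib); lia.
case: m {IH dab} ab p0 pm ep injp indp Yp inner => [|[|m]] ab p0 pm ep injp indp Yp inner.
- by rewrite -p0 pm; apply: linked_refl; split=> //; apply: GY Nb.1.
- apply: linked_edge; split=> //; have [] := ep 0 isT; by rewrite p0 pm.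
(* q runs from x along the geodesic and back to x *)
exfalso; pose q i := if i is j.+1 then if j <= m.+2 then p j else x else x.
have injq i j : i < m.+4 -> j < m.+4 -> q i = q j -> i = j.
  have nx k : k <= m.+2 -> p k <> x by move=> /Yp Yk E; apply: nYx; rewrite -E.
  case: i j => [|i] [|j] //; rewrite !ltnS /=.
  - by move=> _ lt_j; rewrite lt_j => E; case: (nx j lt_j).
  - by move=> lt_i _; rewrite lt_i => E; case: (nx i lt_i).
  by move=> lt_i lt_j; rewrite lt_i lt_j => /injp->.
have le_r : m.+4 <= r.
  rewrite -card_le_II; apply: card_le_trans cardY.
  have /card_eqPle[_ le_q] : (q @` `I_m.+4 #= `I_m.+4)%card.
    by apply: inj_card_eq => i j; rewrite !inE; apply: injq.
  apply: card_le_trans le_q (subset_card_le _) => _ [[|i] lt_i <-]; first by right.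
  by left; rewrite /q; rewrite /= !ltnS in lt_i; rewrite lt_i; apply: Yp.
have eq i : i < m.+4 -> edge G (q i) (q i.+1).
  case: i => [|i]; first by rewrite /= p0; case: Na.
  rewrite !ltnS /= => le_i; rewrite le_i; case: ltnP => lt_i; first by case: (ep i lt_i).
  have -> : i = m.+2 by lia.
  by rewrite pm; apply: edge_sym; case: Nb.
have consec i j : i < j -> j < m.+4 -> edge G (q i) (q j) ->
    j = i.+1 \/ (i = 0 /\ j = m.+3).
  case: i j => [|i] [|j] //; rewrite !ltnS /= => lt_ij le_j; rewrite le_j.
    move=> xj; case: j le_j xj {lt_ij} => [|j] le_j xj; first by left.
    right; split=> //; congr _.+1; apply: contrapT => ne; apply: inner.
    by exists j.+1 => //; lia.
  rewrite (leq_trans (ltnW lt_ij) le_j) => ij; left; congr _.+1.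
  by apply: indp => //; split=> //; apply: Yp => //; lia.
have qend : q m.+4 = q 0 by rewrite /q ltnn.
have [i [j [nij nji nji' eij]]] :=
  short_cycle_chord lc (isT : 4 <= m.+4) le_r qend eq injq.
have cons (k l : 'I_m.+4) : k < l -> edge G (q k) (q l) -> l = ordS k \/ k = ordS l.
  move=> lt_kl /(consec _ _ lt_kl (ltn_ord l))[E|[k0 E]]; [left|right].
    by apply: val_inj; rewrite /= modn_small -?E ?ltn_ord.
  by apply: val_inj; rewrite /= E modnn.
case: (ltngtP i j) => [lt_ij|lt_ji|/val_inj E].
- by case: (cons i j lt_ij eij) => E; move: nji nji'; rewrite E eqxx.
- by case: (cons j i lt_ji (edge_sym eij)) => E; move: nji nji'; rewrite E eqxx.
- by move: nij; rewrite E eqxx.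
Qed.

Lemma acyclic_of_locally_chordal r : locally_chordal r G -> k_acyclic G R r.
Proof.
move=> lc X GX cardX; apply: acyclic_union_walks => // f n Xf adj.
have Gf i : vert G (f i) := GX _ (Xf i).
elim: n adj => [|n IH] adj.
  have -> : f @` `I_1 = [set f 0].
    by apply/seteqP; split=> [_ [[|//] _ <-]|_ ->]; last exists 0.
  exact: acyclic_union1.
have adj' i : i < n -> f i = f i.+1 \/ edge G (f i) (f i.+1).
  by move=> lt_i; apply: adj; apply: ltnW.
have aY := IH adj'; have cY := @connected_induced_path _ G f n adj'.
rewrite IIS image_setU image_set1.
set Y := f @` _ in aY cY *; set x := f n.+1.
have [Yx|nYx] := pselect (Y x); first by rewrite setUidl // => _ ->.
have GY : Y `<=` vert G by move=> _ [i _ <-].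
have Gx : vert G x by apply: Gf.
apply: (acyclic_union_add Gx GY nYx aY).
apply: (nbrs_connected_of_locally_chordal lc Gx GY nYx cY).
apply: card_le_trans cardX; apply: subset_card_le => s.
by case=> [[i _ <-]|->]; apply: Xf.
Qed.

End Representation.

Theorem theorem5 (V W : Type) (G : graph V) (H : graph W) (R : V -> graph W)
    (r : nat)
    (hR : region_representation G H R) (h3 : k_acyclic G R 3) (hr : 3 < r) :
  locally_chordal r G <-> k_acyclic G R r.
Proof.
split; first exact: acyclic_of_locally_chordal hR h3 r.
exact: locally_chordal_of_acyclic hR h3 r hr.
Qed.
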